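(* Let $(\lambda_{i,j})_{i,j\ge1}\in\Lambda$ be the array corresponding to a strong first-order element of $\mathcal{S}eq$. Then there exist $a_1\in\mathbb{K}\setminus\{0\}$ and $a_2,b\in\mathbb{K}$ such that $(\lambda_{i,j})_{i,j\geq 1}$ is given, for all $i,j\ge1$, by one of the following (with all displayed denominators nonzero): Case A: $\lambda_{i,1}=a_1i+b$, $\lambda_{i,2}=a_2i+b$, and $\lambda_{i,j}=\dfrac{a_1a_2\,i}{(j-1)a_1-(j-2)a_2}+b$ for $j\ge3$. Case B: $\lambda_{i,2}=a_2i-2a_2$, and $\lambda_{i,j}=a_1i-2a_1$ for $j\ne2$. Case C: $\lambda_{i,1}=a_1i+2a_1$, $\lambda_{i,2}=a_2i+4a_2$, and $\lambda_{i,j}=\dfrac{a_1a_2(2j+i)}{\frac{(j-1)j(j+1)}{6}a_1-\frac{(j-2)j(j+2)}{3}a_2}$ for $j\ge3$. Case D: $\lambda_{i,1}=a_1i+a_1$, $\lambda_{i,2}=a_2i+2a_2$, and $\lambda_{i,j}=\dfrac{a_1a_2(i+j)}{\frac{(j-1)j}{2}a_1-(j-2)j\,a_2}$ for $j\ge3$. Case E: $\lambda_{i,1}=a_1i+b$, and $\lambda_{i,j}=0$ for $j\ge2$.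
   Context: $\mathbb{K}$ is a field of characteristic zero. $H_{CK}$ is the Connes-Kreimer Hopf algebra of rooted trees over $\mathbb{K}$: the polynomial algebra on the set of nonempty (non-planar) rooted trees, monomials being identified with forests, unit $1$ = empty forest, graded by the number of vertices. The coproduct is the algebra morphism given on a tree $t$ by $\Delta(t)=t\otimes 1+1\otimes t+\sum_c P^c(t)\otimes R^c(t)$, where $c$ runs over non-empty admissible cuts (non-empty sets of edges containing at most one edge of any path from the root to a leaf), $R^c(t)$ is the component containing the root after removing the edges of $c$, and $P^c(t)$ is the forest of the other components. $\bullet$ is the one-vertex tree. $\mathcal{S}eq$ is the set of sequences $(t_n)_{n\ge1}$ in $H_{CK}$ such that each $t_n$ is a nonzero linear combination of trees with $n$ vertices, $t_1=\bullet$, and the subalgebra generated by the $t_n$ is a Hopf subalgebra. $\Lambda$ is the set of double sequences $(\lambda_{i,j})_{i,j\ge1}$ in $\mathbb{K}$ such that $\lambda_{i,j}\lambda_{i+j,k}-\lambda_{j,k}\lambda_{i,j+k}=\lambda_{i,k}\lambda_{i+k,j}-\lambda_{k,j}\lambda_{i,j+k}$ for all $i,j,k\ge1$ and such that for every $n\ge2$ there are $i,j\ge1$ with $i+j=n$ and $\lambda_{i,j}\ne0$. The array in $\Lambda$ corresponding to $(t_n)\in\mathcal{S}eq$ has $\lambda_{i,j}$ = coefficient of $t_j\otimes t_i$ in $\Delta(t_{i+j})$ (in the basis of tensors of monomials in the $t_n$); this correspondence is a bijection $\mathcal{S}eq\to\Lambda$. An element of $\mathcal{S}eq$ is a strong first-order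 sequence if for every $j\ge1$, $\lambda_{i,j}$ is given by a polynomial in $i$ of degree at most $1$ (i.e. $\lambda_{i,j}=\alpha_ji+\beta_j$ with $\alpha_j,\beta_j\in\mathbb{K}$), and for $j=1$ the degree is exactly $1$. *)

(* Defs.v *)
From HB Require Import structures.
From mathcomp Require Import all_boot all_order all_algebra.
From mathcomp Require Import generic_quotient finmap.
From mathcomp Require Import monalg.

Set Implicit Arguments.
Unset Strict Implicit.
Unset Printing Implicit Defensive.

Import GRing.Theory.
Local Open Scope ring_scope.
Local Open Scope quotient_scope.

(* A rooted tree together with an order on the children of each vertex; the
   non-planar rooted trees are the quotient [rtree] below. *)
Inductive ptree : predArgType := PNode of seq ptree.

Definition children (t : ptree) : seq ptree := let: PNode s := t in s.
Definition pleaf : ptree := PNode [::].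

Fixpoint ptree_code (t : ptree) : GenTree.tree unit :=
  let: PNode s := t in GenTree.Node 0 (map ptree_code s).

Fixpoint ptree_decode (t : GenTree.tree unit) : ptree :=
  if t is GenTree.Node _ s then PNode (map ptree_decode s) else pleaf.

Fixpoint ptree_elim (P : ptree -> Prop)
    (Pnode : forall s, foldr (fun t => and (P t)) True s -> P (PNode s))
    (t : ptree) : P t :=
  let: PNode s := t in
  Pnode s ((fix elim_seq s : foldr (fun t => and (P t)) True s :=
    if s is u :: s' then conj (ptree_elim Pnode u) (elim_seq s') else I) s).

Lemma ptree_codeK : cancel ptree_code ptree_decode.
Proof.
elim/ptree_elim=> s IH /=; congr PNode.
by elim: s IH => //= t s IHs [-> /IHs ->].
Qed.

HB.instance Definition _ := Countable.copy ptree (can_type ptree_codeK).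

Lemma ptree_ind_mem (P : ptree -> Prop) :
  (forall s, {in s, forall t, P t} -> P (PNode s)) -> forall t, P t.
Proof.
move=> Pnode; elim/ptree_elim=> s IH; apply: Pnode => t.
elim: s IH => //= u s IHs [Pu Ps]; rewrite inE => /predU1P[->//|].
exact: IHs.
Qed.

(* The children can be matched bijectively with isomorphic subtrees. *)
Fixpoint ptree_iso (t u : ptree) {struct t} : bool :=
  let: PNode s := t in has (all2 ptree_iso s) (permutations (children u)).

Lemma ptree_isoP s r :
  reflect (exists2 r', perm_eq r' r & all2 ptree_iso s r')
          (ptree_iso (PNode s) (PNode r)).
Proof.
apply: (iffP hasP) => -[r' r'r sr']; exists r' => //.
  by rewrite mem_permutations in r'r.
by rewrite mem_permutations.
Qed.

Lemma all2_nthP (e : rel ptree) s r :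
  reflect (size s = size r /\
           forall i, (i < size s)%N -> e (nth pleaf s i) (nth pleaf r i))
          (all2 e s r).
Proof.
elim: s r => [|x s IHs] [|y r] /=; try by constructor; case.
  by constructor; split.
apply: (iffP andP) => [[exy /IHs[-> sr]]|[[szs] sr]].
  by split=> // -[|i] //=; apply: sr.
split; first exact: (sr 0).
by apply/IHs; split=> // i; apply: (sr i.+1).
Qed.

Lemma all2_perm (e : rel ptree) s s' r :
  all2 e s r -> perm_eq s' s -> exists2 r', perm_eq r' r & all2 e s' r'.
Proof.
move=> /all2_nthP[szr esr] /(perm_iotaP pleaf)[Is IsP ->].
exists (map (nth pleaf r) Is).
  by apply/(perm_iotaP pleaf); exists Is; rewrite -?szr.
apply/all2_nthP; split=> [|i]; rewrite !size_map // => iIs.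
rewrite !(nth_map 0%N) //; apply: esr.
have : nth 0%N Is i \in Is by apply: mem_nth.
by rewrite (perm_mem IsP) mem_iota.
Qed.

Lemma ptree_iso_refl : reflexive ptree_iso.
Proof.
elim/ptree_ind_mem=> s IH; apply/ptree_isoP; exists s => //.
by apply/all2_nthP; split=> // i ilt; apply/IH/mem_nth.
Qed.

Lemma ptree_iso_sym_imp t u : ptree_iso t u -> ptree_iso u t.
Proof.
elim/ptree_ind_mem: t u => s IH [r] /ptree_isoP[r' r'r /all2_nthP[sz sr']].
have r's : all2 ptree_iso r' s.
  by apply/all2_nthP; split=> // i ilt; apply/IH/sr'; rewrite ?mem_nth ?sz.
have [|s' s's rs'] := all2_perm r's (s' := r); first by rewrite perm_sym.
by apply/ptree_isoP; exists s'.
Qed.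

Lemma ptree_iso_sym : symmetric ptree_iso.
Proof. by move=> t u; apply/idP/idP; apply: ptree_iso_sym_imp. Qed.

Lemma ptree_iso_trans : transitive ptree_iso.
Proof.
move=> u t v; elim/ptree_ind_mem: t u v => s IH [r] [q].
move=> /ptree_isoP[r' r'r sr'] /ptree_isoP[q' q'q rq'].
have [q2 q2q' r'q2] := all2_perm rq' r'r.
apply/ptree_isoP; exists q2; first exact: perm_trans q2q' q'q.
move/all2_nthP: sr' => [szs sr']; move/all2_nthP: r'q2 => [szr r'q2].
apply/all2_nthP; split=> [|i ilt]; first by rewrite szs.
by apply: IH (sr' i ilt) (r'q2 i _); rewrite ?mem_nth -?szs.
Qed.

Canonical ptree_iso_equiv :=
  EquivRel ptree_iso ptree_iso_refl ptree_iso_sym ptree_iso_trans.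

Definition rtree := {eq_quot ptree_iso}.

(* A vertex is addressed by the word of child indices leading to it from the
   root, and an edge by the address of its lower end. *)
Fixpoint vertices (t : ptree) : seq (seq nat) :=
  let: PNode s := t in
  let vs := map vertices s in
  [::] :: [seq i :: v | i <- iota 0 (size s), v <- nth [::] vs i].

Definition edges (t : ptree) : seq (seq nat) :=
  [seq v <- vertices t | v != [::]].

Fixpoint subtree (t : ptree) (v : seq nat) {struct v} : ptree :=
  if v is i :: v' then subtree (nth pleaf (children t) i) v' else t.

Definition leaves (t : ptree) : seq (seq nat) :=
  [seq v <- vertices t | children (subtree t v) == [::]].

Definition tree_size (t : ptree) : nat := size (vertices t).

(* The component of the root of [t] once the edges in [c] are removed. *)
Fixpoint root_component (t : ptree) (c : pred (seq nat)) {struct t} : ptree :=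
  let: PNode s := t in
  let rs := map root_component s in
  PNode [seq nth (fun=> pleaf) rs i (fun v => c (i :: v))
        | i <- iota 0 (size s) & ~~ c [:: i]].

Definition cut (t : ptree) := {set seq_sub (edges t)}.

Definition cut_edge (t : ptree) (c : cut t) : pred (seq nat) :=
  fun v => [exists e in c, val e == v].

(* The edges on the path from the root to [l] are the prefixes of [l]. *)
Definition admissible (t : ptree) (c : cut t) : bool :=
  (c != set0) && all (fun l => #|[set e in c | prefix (val e) l]| <= 1)%N (leaves t).

Definition forest := {cmonom rtree}.

Definition tree_forest (t : rtree) : forest := ucm t.

Definition cut_R (t : ptree) (c : cut t) : rtree :=
  \pi_rtree (root_component t (cut_edge c)).

(* The components other than that of the root are those of the lower ends of
   the removed edges. *)
Definition cut_P (t : ptree) (c : cut t) : forest :=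
  \big[mmul/mone]_(e in c) tree_forest
    (\pi_rtree (root_component (subtree t (val e))
                               (fun v => cut_edge c (val e ++ v)))).

(* The tensor product of two monoid algebras is the algebra of the product
   monoid, a pair of monomials standing for their tensor product. *)
Section PairMonomial.
Variables M N : conomType.
Implicit Types x y z : M * N.

Definition pair_one : M * N := (mone, mone).
Definition pair_mul x y : M * N := (mmul x.1 y.1, mmul x.2 y.2).

Lemma pair_mulA : associative pair_mul.
Proof. by move=> x y z; rewrite /pair_mul !mulmA. Qed.

Lemma pair_mul1 : left_id pair_one pair_mul.
Proof. by move=> [a b]; rewrite /pair_mul !mul1m. Qed.

Lemma pair_mulC : commutative pair_mul.
Proof.
by move=> x y; rewrite /pair_mul (mulmC x.1) (mulmC x.2).
Qed.

Lemma pair_mul1r : right_id pair_one pair_mul.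
Proof. by move=> x; rewrite pair_mulC pair_mul1. Qed.

Lemma pair_unit x y :
  pair_mul x y = pair_one -> x = pair_one /\ y = pair_one.
Proof.
by case: x y => [a b] [a' b'] [/unitm[-> ->] /unitm[-> ->]].
Qed.

HB.instance Definition _ := Choice_isMonomialDef.Build (M * N)%type
  pair_mulA pair_mul1 pair_mul1r pair_unit.
HB.instance Definition _ := MonomialDef_isConomialDef.Build (M * N)%type
  pair_mulC.
End PairMonomial.

Notation HCK K := {malg K[forest]}.
Notation HCK2 K := {malg K[(forest * forest)%type]}.

Section Hopf.
Variable K : fieldType.

Definition tree_elt (t : rtree) : HCK K := << tree_forest t >>.

Definition tensor (x y : HCK K) : HCK2 K :=
  \sum_(m <- msupp x) \sum_(n <- msupp y) << x@_m * y@_n *g (m, n) >>.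

(* The choice of a planar representative of [t] is immaterial. *)
Definition coproduct_tree (t : rtree) : HCK2 K :=
  tensor (tree_elt t) 1 + tensor 1 (tree_elt t) +
  \sum_(c : cut (repr t) | admissible c)
     tensor << cut_P c >> (tree_elt (cut_R c)).

Definition coproduct (x : HCK K) : HCK2 K :=
  \sum_(m <- msupp x) x@_m *: \prod_(t <- finsupp m) coproduct_tree t ^+ m t.

Lemma coproduct_tree_elt t : coproduct (tree_elt t) = coproduct_tree t.
Proof.
rewrite /coproduct msuppU1 big_seq_fset1 mcoeffUU scale1r mdomU big_seq_fset1.
by rewrite cmUU expr1.
Qed.

Lemma coproductM : {morph coproduct : x y / x * y}.
Proof.
pose h (m : forest) := \prod_(t <- finsupp m) coproduct_tree t ^+ m t.
have hE (d : {fset rtree}) (m : forest) :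
    (finsupp m `<=` d)%fset -> h m = \prod_(t <- d) coproduct_tree t ^+ m t.
  move=> md; rewrite /h; apply: big_fset_incl => // t td tm.
  by move: tm; rewrite -cmE_eq0 => /eqP->; rewrite expr0.
have hM : mmorphism h.
  split=> [m n|]; last by rewrite /h mdom1 big_seq_fset0.
  pose d := (finsupp m `|` finsupp n)%fset.
  rewrite (hE d) ?(hE d m) ?(hE d n) ?mdomD ?fsubsetUl ?fsubsetUr //.
  by rewrite -big_split; apply: eq_bigr => t _; rewrite cmM exprD.
have cE x : coproduct x = mmap (@malgC _ K) h x.
  by rewrite mmapE; apply: eq_bigr => m _; rewrite mul_malgC.
pose hh := MMorphism.Pack (MMorphism.Class (isMultiplicative.Build _ _ h hM)).
by move=> x y; rewrite !cE; exact: (rmorphM (mmap (@malgC _ K) hh)).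
Qed.

Definition convolution (f g : HCK K -> HCK K) (x : HCK K) : HCK K :=
  let d := coproduct x in
  \sum_(p <- msupp d) d@_p *: (f << p.1 >> * g << p.2 >>).

(* The counit of [x] is its coefficient on the empty forest. *)
Definition is_antipode (S : {linear HCK K -> HCK K}) : Prop :=
  forall x, convolution S idfun x = (x@_mone)%:MP /\
            convolution idfun S x = (x@_mone)%:MP.

Definition is_subalgebra (A : HCK K -> Prop) : Prop :=
  [/\ A 1, forall a x y, A x -> A y -> A (a *: x + y)
    & forall x y, A x -> A y -> A (x * y)].

Definition in_tensor_square (A : HCK K -> Prop) (z : HCK2 K) : Prop :=
  exists2 s : seq (HCK K * HCK K), {in s, forall p, A p.1 /\ A p.2}
    & z = \sum_(p <- s) tensor p.1 p.2.

(* Quantifying over [S] only names the antipode, which is unique. *)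
Definition is_hopf_subalgebra (A : HCK K -> Prop) : Prop :=
  [/\ is_subalgebra A,
      forall x, A x -> in_tensor_square A (coproduct x)
    & forall S, is_antipode S -> forall x, A x -> A (S x)].

(* Sequences and arrays are indexed by positive integers: values at index 0
   are irrelevant throughout. *)
Definition generated (t : nat -> HCK K) (x : HCK K) : Prop :=
  forall A, is_subalgebra A -> (forall n, (0 < n)%N -> A (t n)) -> A x.

Definition tree_combination (n : nat) (x : HCK K) : Prop :=
  forall m, m \in msupp x ->
    exists2 u : rtree, tree_size (repr u) = n & m = tree_forest u.

Definition in_Seq (t : nat -> HCK K) : Prop :=
  [/\ forall n, (0 < n)%N -> t n != 0 /\ tree_combination n (t n),
      t 1%N = tree_elt (\pi_rtree pleaf)
    & is_hopf_subalgebra (generated t)].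

Definition in_Lambda (lam : nat -> nat -> K) : Prop :=
  (forall i j k, (0 < i)%N -> (0 < j)%N -> (0 < k)%N ->
     lam i j * lam (i + j)%N k - lam j k * lam i (j + k)%N =
     lam i k * lam (i + k)%N j - lam k j * lam i (j + k)%N) /\
  (forall n, (2 <= n)%N ->
     exists i j, [/\ (0 < i)%N, (0 < j)%N, (i + j)%N = n & lam i j != 0]).

Definition posnat := {n : nat | (0 < n)%N}.

Definition seq_monomial (t : nat -> HCK K) (m : {cmonom posnat}) : HCK K :=
  \prod_(n <- finsupp m) t (val n) ^+ m n.

(* [c] collects the coordinates of the coproduct of [t (i + j)] in the tensors
   of monomials in the [t n]; they are unique since the [t n], being nonzero
   combinations of trees of pairwise distinct sizes, are algebraically
   independent. *)
Definition array_of (t : nat -> HCK K) (lam : nat -> nat -> K) : Prop :=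
  forall i j : posnat,
  exists c : {malg K[({cmonom posnat} * {cmonom posnat})%type]},
    coproduct (t (val i + val j)%N) =
      \sum_(p <- msupp c)
         c@_p *: tensor (seq_monomial t p.1) (seq_monomial t p.2) /\
    lam (val i) (val j) = c@_(ucm j, ucm i).

Definition strong_first_order (lam : nat -> nat -> K) : Prop :=
  (forall j, (0 < j)%N -> exists alpha beta : K,
     forall i, (0 < i)%N -> lam i j = alpha * i%:R + beta) /\
  (exists2 alpha : K, alpha != 0 & exists beta : K,
     forall i, (0 < i)%N -> lam i 1%N = alpha * i%:R + beta).
End Hopf.

(* Main.v *)
Require Import Defs.
From HB Require Import structures.
From mathcomp Require Import all_boot all_order all_algebra.
From mathcomp Require Import generic_quotient finmap.
From mathcomp Require Import monalg.
From mathcomp Require Import ring.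

Set Implicit Arguments.
Unset Strict Implicit.
Unset Printing Implicit Defensive.

Import GRing.Theory.
Local Open Scope ring_scope.

(* Write [lam i j = x_j i + y_j].  Comparing coefficients of [i] in the defining
   relation of Lambda gives, with [D_jk = x_k j + y_k - x_j k - y_j],
     [D_jk x_(j+k) = (j - k) x_j x_k] and
     [D_jk y_(j+k) = j x_k y_j - k x_j y_k].
   If [x_2 = 0], these and nondegeneracy leave only case E and case A with
   [a2 = 0].  Otherwise no [x_j] vanishes, and for [u_j = 1 / x_j],
   [v_j = y_j / x_j] they become linear in each family:
     [(j - k) v_(j+k) = j v_j - k v_k] and
     [(j - k) u_(j+k) = (j + v_k) u_j - (k + v_j) u_k].
   The first forces [v_j = c + d j].  Taking [k = 1], the second determines [u]
   from [u_1] and [u_2]; its consistency at [j + k = 5] and [j + k = 7] forces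
   [v] to be a multiple of [u] (case A) or [(c, d)] to be one of [(-2, 0)],
   [(0, 2)], [(0, 1)], [(-1, 0)] (cases B, C, D, and one excluded by
   [lam 1 1 <> 0]). *)

(** * Linear recurrences satisfied by the ratios *)

Section Ratios.
Variables (K : fieldType) (u v : nat -> K).
Hypothesis char0 : [pchar K] =i pred0.
Hypothesis v_rel : forall j k, (0 < j)%N -> (0 < k)%N ->
  (j%:R - k%:R) * v (j + k)%N = j%:R * v j - k%:R * v k.
Hypothesis u_rel : forall j k, (0 < j)%N -> (0 < k)%N ->
  (j%:R - k%:R) * u (j + k)%N = (j%:R + v k) * u j - (k%:R + v j) * u k.

Lemma natr_neq0 n : (0 < n)%N -> n%:R != 0 :> K.
Proof. by move/pcharf0P: char0 => ->; rewrite lt0n. Qed.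

(** The recurrence links consecutive indices from 2 on, and its leading factor [j] is invertible in
    characteristic zero, so the value at 2 determines all later ones. *)
Lemma ratio_recurrence_uniq (f g h : nat -> K) :
  (forall j, (0 < j)%N -> j%:R * f j.+2 = g j.+1 * f j.+1 + h j.+1) ->
  forall f' : nat -> K,
  (forall j, (0 < j)%N -> j%:R * f' j.+2 = g j.+1 * f' j.+1 + h j.+1) ->
  f 2%N = f' 2%N -> forall j, (2 <= j)%N -> f j = f' j.
Proof.
move=> fE f' f'E f2 [|[|j]] // _; elim: j => // j IH.
by apply: (mulfI (natr_neq0 (ltn0Sn j))); rewrite fE // f'E // IH.
Qed.

(** At [k = 1], [v_rel] becomes a recurrence that the affine function with the same values at 1 and
    2 also solves. *)
Lemma v_affine j : (0 < j)%N ->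
  v j = 2%:R * v 1%N - v 2%N + (v 2%N - v 1%N) * j%:R.
Proof.
case: j => [|[|j]] // _; first by ring.
apply: (@ratio_recurrence_uniq v (fun j => j%:R) (fun=> - v 1%N) _
  (fun j => 2%:R * v 1%N - v 2%N + (v 2%N - v 1%N) * j%:R)) => // [i _|i _|].
- have := v_rel (ltn0Sn i) (ltn0Sn 0); rewrite addn1 mul1r => <-; ring.
- by ring.
- by ring.
Qed.

(** Serves to identify closed forms: the recurrence required of [f] is [u_rel] at [k = 1]. *)
Lemma u_unique (f : nat -> K) : f 2%N = u 2%N ->
  (forall j, (0 < j)%N ->
     j%:R * f j.+2 = (j.+1%:R + v 1%N) * f j.+1 - (1 + v j.+1) * u 1%N) ->
  forall j, (2 <= j)%N -> u j = f j.
Proof.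
move=> f2 fE; apply: (@ratio_recurrence_uniq u (fun j => j%:R + v 1%N)
  (fun j => - (1 + v j) * u 1%N)) => // j j0.
  have := u_rel (ltn0Sn j) (ltn0Sn 0); rewrite addn1 mulNr => <-; ring.
by rewrite fE // mulNr.
Qed.

(* The two ways of computing [u 5], and of computing [u 7], from [u 1] and
   [u 2]. *)
Lemma u_obstruction (c d : K) :
  (forall j, (0 < j)%N -> v j = c + d * j%:R) ->
  let V := v 2%N * u 1%N - v 1%N * u 2%N in
  V * ((c + d) ^+ 2 + 3%:R * (c - d) + 2%:R) = 0 /\ V * (c * d) = 0.
Proof.
move=> vE V.
have e3 := u_rel (isT : 0 < 2)%N (isT : 0 < 1)%N.
have e4 := u_rel (isT : 0 < 3)%N (isT : 0 < 1)%N.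
have e5 := u_rel (isT : 0 < 4)%N (isT : 0 < 1)%N.
have e5' := u_rel (isT : 0 < 3)%N (isT : 0 < 2)%N.
have e7 := u_rel (isT : 0 < 4)%N (isT : 0 < 3)%N.
have e7' := u_rel (isT : 0 < 5)%N (isT : 0 < 2)%N.
rewrite !addnE /= !vE // in e3 e4 e5 e5' e7 e7'.
have {}e3 : u 3%N = (2%:R + c + d) * u 2%N - (1 + c + 2%:R * d) * u 1%N.
  by transitivity ((2%:R - 1) * u 3%N); [ring | rewrite e3; ring].
have {}e4 : 2%:R * u 4%N = (3%:R + c + d) * u 3%N - (1 + c + 3%:R * d) * u 1%N.
  by transitivity ((3%:R - 1) * u 4%N); [ring | rewrite e4; ring].
have {}e5' : u 5%N = (3%:R + c + 2%:R * d) * u 3%N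
    - (2%:R + c + 3%:R * d) * u 2%N.
  by transitivity ((3%:R - 2%:R) * u 5%N); [ring | rewrite e5'; ring].
have {}e7 : u 7%N = (4%:R + c + 3%:R * d) * u 4%N
    - (3%:R + c + 4%:R * d) * u 3%N.
  by transitivity ((4%:R - 3%:R) * u 7%N); [ring | rewrite e7; ring].
(* The relation for 4 + 1 is doubled so that [e4] applies without division; [u 5] takes its value
   from 3 + 2. Next, 5 + 2 is compared with 4 + 3 in the same way. *)
have R5 : V * ((c + d) ^+ 2 + 3%:R * (c - d) + 2%:R) = 0.
  transitivity (2%:R * (3%:R * u 5%N)
    - ((4%:R + c + d) * (2%:R * u 4%N) - 2%:R * (1 + c + 4%:R * d) * u 1%N)).
    by rewrite e4 e5' e3 /V !vE //; ring.
  have -> : 3%:R * u 5%N = (4%:R - 1) * u 5%N by ring.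
  by rewrite e5; ring.
have R7 : V * (c ^+ 2 + 4%:R * c * d + d ^+ 2 + 3%:R * (c - d) + 2%:R) = 0.
  transitivity (2%:R * ((5%:R - 2%:R) * u 7%N)
    - 3%:R * ((4%:R + c + 3%:R * d) * (2%:R * u 4%N)
              - 2%:R * (3%:R + c + 4%:R * d) * u 3%N)).
    by rewrite e7' e4 e5' e3 /V !vE //; ring.
  by rewrite e7; ring.
(* The two quadratics differ by [2 c d]. *)
split=> //; apply: (mulfI (natr_neq0 (isT : 0 < 2)%N)).
transitivity (V * (c ^+ 2 + 4%:R * c * d + d ^+ 2 + 3%:R * (c - d) + 2%:R)
  - V * ((c + d) ^+ 2 + 3%:R * (c - d) + 2%:R)); first by ring.
by rewrite R5 R7; ring.
Qed.

(** When the factor [V] of the obstruction is nonzero, [c d = 0], and the quadratic becomes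
    [(d - 1) (d - 2)] if [c = 0] and [(c + 1) (c + 2)] if [d = 0]. The root [c = -1] would give
    [v 1 = -1]. *)
Lemma ratio_classification : v 1%N != -1 ->
  [\/ v 2%N * u 1%N = v 1%N * u 2%N,
      forall j, (0 < j)%N -> v j = - 2%:R,
      forall j, (0 < j)%N -> v j = 2%:R * j%:R
    | forall j, (0 < j)%N -> v j = j%:R].
Proof.
move=> v1N1; pose d := v 2%N - v 1%N; pose c := 2%:R * v 1%N - v 2%N.
have vE j : (0 < j)%N -> v j = c + d * j%:R by exact: v_affine.
clearbody c d; have [/eqP + /eqP] := u_obstruction vE.
rewrite !mulf_eq0 !subr_eq0.
have [/eqP|_ /=] := eqVneq (v 2%N * u 1%N) (v 1%N * u 2%N).
  by move=> /eqP e _ _; constructor 1.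
move=> R5 /orP[/eqP c0 | /eqP d0]; move: R5.
  have -> : (c + d) ^+ 2 + 3%:R * (c - d) + 2%:R = (d - 1) * (d - 2%:R).
    by rewrite c0; ring.
  rewrite mulf_eq0 !subr_eq0 => /orP[] /eqP d1.
    by constructor 4 => j j0; rewrite vE // c0 d1; ring.
  by constructor 3 => j j0; rewrite vE // c0 d1; ring.
have -> : (c + d) ^+ 2 + 3%:R * (c - d) + 2%:R = (c - - 1) * (c - - 2%:R).
  by rewrite d0; ring.
rewrite mulf_eq0 !subr_eq0 => /orP[] /eqP c1.
  by case/eqP: v1N1; rewrite vE // c1 d0; ring.
by constructor 2 => j j0; rewrite vE // c1 d0; ring.
Qed.
End Ratios.

(** * Vanishing of the slopes [x] and intercepts [y] *)

Section FirstOrder.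
Variables (K : fieldType) (x y : nat -> K).
Hypothesis char0 : [pchar K] =i pred0.
Let D j k : K := x k * j%:R + y k - x j * k%:R - y j.
Hypothesis x_rel : forall j k, (0 < j)%N -> (0 < k)%N ->
  D j k * x (j + k)%N = (j%:R - k%:R) * x j * x k.
Hypothesis y_rel : forall j k, (0 < j)%N -> (0 < k)%N ->
  D j k * y (j + k)%N = j%:R * x k * y j - k%:R * x j * y k.
Hypothesis nondegenerate : forall n, (2 <= n)%N -> exists i j,
  [/\ (0 < i)%N, (0 < j)%N, (i + j)%N = n & x j * i%:R + y j != 0].
Hypothesis x1_neq0 : x 1%N != 0.

Lemma xy11_neq0 : x 1%N + y 1%N != 0.
Proof.
have [[|i] [[|j] [//= _ _]]] := nondegenerate (isT : 2 <= 2)%N.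
by case: i j => [|i] [|j] //; rewrite ?mulr1 // !addnS.
Qed.

(* If [x j = y j = 0] for [2 <= j <= n], then [D n 1 = 0] would make every
   [x j * (n + 1 - j) + y j] vanish, against nondegeneracy. *)
Lemma xy_eq0 : x 2%N = 0 -> y 2%N = 0 ->
  forall j, (2 <= j)%N -> x j = 0 /\ y j = 0.
Proof.
move=> x2 y2.
suff IH n m : (2 <= m <= n)%N -> x m = 0 /\ y m = 0.
  by move=> j j2; apply: (IH j); rewrite j2 leqnn.
elim: n m => [|n IHn] m /andP[m2]; first by rewrite leqn0; case: m m2.
rewrite leq_eqVlt => /predU1P[mE|mn]; last by apply: IHn; rewrite m2.
have [n2|n2] := leqP 2 n; last first.
  by have -> : m = 2%N by apply/anti_leq; rewrite m2 mE andbT.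
have [xn yn] := IHn n (introT andP (conj n2 (leqnn n))).
have n0 : (0 < n)%N by exact: ltnW.
have D0 : D n 1 != 0.
  have [i [j [i0 j0 ijn]]] := nondegenerate (leqW n2).
  have [j2|j1] := leqP 2 j.
    have jn : (j <= n)%N by rewrite -ltnS -ijn -[X in (X < _)%N]add0n ltn_add2r.
    have [|-> ->] := IHn j; first by rewrite j2.
    by rewrite mul0r addr0 eqxx.
  (* The nonzero entry has [j = 1], hence [i = n], and it equals [D n 1]. *)
  have {j0 j1}j1 : j = 1%N by apply/anti_leq; rewrite -ltnS j1.
  move: ijn; rewrite j1 addn1 => -[->].
  by rewrite /D xn yn mul0r !subr0.
have := x_rel n0 (ltn0Sn 0); have := y_rel n0 (ltn0Sn 0).
rewrite xn yn !(mulr0, mul0r) subr0 addn1 -mE => /eqP + /eqP.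
by rewrite !mulf_eq0 (negPf D0) /= => /eqP-> /eqP->.
Qed.

(** At [k = 1], a zero pair at [j + 1] forces [x j = 0] by [x_rel] and then [y j = 0] by [y_rel], so
    it would descend to index 2. *)
Lemma xy_neq0 : (x 2%N != 0) || (y 2%N != 0) ->
  forall j, (2 <= j)%N -> (x j != 0) || (y j != 0).
Proof.
move=> xy2 [|[|j]] // _; elim: j => // j; apply: contraLR.
rewrite !negb_or !negbK => /andP[/eqP xS /eqP yS].
have := x_rel (ltn0Sn j.+1) (ltn0Sn 0); have := y_rel (ltn0Sn j.+1) (ltn0Sn 0).
rewrite addn1 xS yS !mulr0 => yE /esym/eqP.
rewrite !mulf_eq0 (negPf x1_neq0) orbF -natrB // subn1 /=.
rewrite (negPf (natr_neq0 char0 _)) //= => /eqP xE; move/esym/eqP: yE.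
rewrite xE !(mulr0, mul0r) subr0 !mulf_eq0 (negPf x1_neq0).
by rewrite (negPf (natr_neq0 char0 _)) //= => ->; rewrite eqxx.
Qed.

(** This yields case A with [a2 = 0]. For [j >= 2], [x j = 0] implies [D j 1 != 0], so the slopes
    vanish by induction; the relations at [(j, 2)] and [(2, 1)] then equate the intercepts. *)
Lemma y_const : x 2%N = 0 -> y 2%N != 0 ->
  forall j, (2 <= j)%N -> x j = 0 /\ y j = y 1%N.
Proof.
move=> x2 y2.
have xy j : (2 <= j)%N -> (x j != 0) || (y j != 0).
  by apply: xy_neq0; rewrite y2 orbT.
have D0 j : (2 <= j)%N -> x j = 0 -> D j 1 != 0.
  move=> j2 xj; have yj : y j != 0 by have := xy j j2; rewrite xj eqxx.
  apply/eqP => Dj; have /esym/eqP := y_rel (ltnW j2) (ltn0Sn 0).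
  rewrite Dj mul0r xj mulr0 mul0r subr0 !mulf_eq0 (negPf x1_neq0) (negPf yj).
  by rewrite (negPf (natr_neq0 char0 _)) // ltnW.
have x0 j : (2 <= j)%N -> x j = 0.
  case: j => [|[|j]] // _; elim: j => // j IH.
  apply: (mulfI (D0 _ (isT : 1 < j.+2)%N IH)).
  by have := x_rel (ltn0Sn j.+1) (ltn0Sn 0); rewrite addn1 IH !(mulr0, mul0r).
have yj0 j : (2 <= j)%N -> y j != 0.
  by move=> j2; have := xy j j2; rewrite x0 // eqxx.
have yE j : (3 <= j)%N -> y j = y 2%N.
  move=> j3; have j2 := ltnW j3; have /eqP := y_rel (ltnW j2) (isT : 0 < 2)%N.
  rewrite /D !x0 // !(mulr0, mul0r) !subr0 add0r mulf_eq0.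
  by rewrite subr_eq0 (negPf (yj0 _ _)) ?orbF ?addn2 // => /eqP->.
have y21 : y 2%N = y 1%N.
  have := y_rel (isT : 0 < 2)%N (isT : 0 < 1)%N; rewrite !addnE /= yE // /D x2.
  rewrite !(mulr0, mul0r) !subr0 => /(mulIf y2) e.
  apply/eqP; rewrite eq_sym -subr_eq0; apply/eqP.
  transitivity (x 1%N * 2%:R + y 1%N - y 2%N - 2%:R * x 1%N); first by ring.
  by rewrite e; ring.
by move=> j j2; split; [exact: x0 | case: j j2 => [|[|[|j]]] // _; rewrite yE].
Qed.

Lemma x_neq0 : x 2%N != 0 -> forall j, (0 < j)%N -> x j != 0.
Proof.
move=> x2 [|[|j]] // _; elim: j => // j IH.
apply/eqP => xS; have /esym/eqP := x_rel (ltn0Sn j.+1) (ltn0Sn 0).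
rewrite addn1 xS mulr0 !mulf_eq0 (negPf x1_neq0) (negPf IH) -natrB // subn1.
by rewrite (negPf (natr_neq0 char0 _)).
Qed.

(** * Passage to the ratios when [x 2] is nonzero *)

Section NonzeroSlope.
Hypothesis x2_neq0 : x 2%N != 0.
Let u j := (x j)^-1.
Let v j := y j / x j.

Lemma D_ratio j k : (0 < j)%N -> (0 < k)%N ->
  D j k = x j * x k * ((j%:R + v k) * u j - (k%:R + v j) * u k).
Proof.
move=> j0 k0; rewrite /D /u /v.
have := x_neq0 x2_neq0 j0; have := x_neq0 x2_neq0 k0.
move: (x j) (x k) (y j) (y k) j%:R k%:R => xj xk yj yk a b xk0 xj0.
by field; rewrite xj0 xk0.
Qed.

Lemma slope_ratio_rel j k : (0 < j)%N -> (0 < k)%N ->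
  (j%:R - k%:R) * u (j + k)%N = (j%:R + v k) * u j - (k%:R + v j) * u k.
Proof.
move=> j0 k0; have xj0 := x_neq0 x2_neq0 j0; have xk0 := x_neq0 x2_neq0 k0.
have xjk0 : x (j + k)%N != 0 by rewrite x_neq0 // addn_gt0 j0.
apply: (mulfI (mulf_neq0 xj0 xk0)); rewrite -D_ratio //.
apply: (mulIf xjk0); rewrite x_rel // /u.
move: (x j) (x k) (x _) j%:R k%:R xjk0 => xj xk xjk a b xjk0.
by field.
Qed.

(** Writing [y (j + k)] as [v (j + k) * x (j + k)] in [y_rel] lets [x_rel] eliminate [D j k]. *)
Lemma value_ratio_rel j k : (0 < j)%N -> (0 < k)%N ->
  (j%:R - k%:R) * v (j + k)%N = j%:R * v j - k%:R * v k.
Proof.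
move=> j0 k0; have xj0 := x_neq0 x2_neq0 j0; have xk0 := x_neq0 x2_neq0 k0.
have xjk0 : x (j + k)%N != 0 by rewrite x_neq0 // addn_gt0 j0.
apply: (mulfI (mulf_neq0 xj0 xk0)).
transitivity (D j k * y (j + k)%N).
  have -> : y (j + k)%N = v (j + k)%N * x (j + k)%N by rewrite /v divfK.
  by rewrite [RHS]mulrCA x_rel //; move: j%:R k%:R => a b; ring.
rewrite y_rel // /v.
move: (x j) (x k) (y j) (y k) j%:R k%:R xj0 xk0 => xj xk yj yk a b xj0 xk0.
by field; rewrite xj0 xk0.
Qed.

(** The nonzero entry at [(1, 1)] is [x 1 * (1 + v 1)]. *)
Lemma v1_neqN1 : v 1%N != -1.
Proof.
apply: contra_neq xy11_neq0 => v1; transitivity (x 1%N * (1 + v 1%N)).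
  by rewrite /v mulrDr mulr1 mulrC divfK.
by rewrite v1; ring.
Qed.

(** [den] is [x 1 * x 2 * u] from index 2 on, which explains its value at 2 and the term [x 2]. It
    is nonzero because [u j] is an inverse. *)
Lemma x_eq_div (den : nat -> K) :
  den 2%N = x 1%N ->
  (forall j, (0 < j)%N ->
     j%:R * den j.+2 =
       (j.+1%:R + v 1%N) * den j.+1 - (1 + v j.+1) * x 2%N) ->
  forall j, (2 <= j)%N -> den j != 0 /\ x j = x 1%N * x 2%N / den j.
Proof.
move=> den2 denE j j2; pose f i := den i / (x 1%N * x 2%N).
have x12 : x 1%N * x 2%N != 0 by rewrite mulf_neq0.
have fE : u j = f j.
  apply: (u_unique char0 slope_ratio_rel) => // [|i i0].
    by rewrite /f den2 /u invfM mulrA divff // mul1r.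
  rewrite /f mulrA denE // mulrBl -!mulrA; congr (_ - _ * _).
  by rewrite /u invfM mulrCA divff // mulr1.
have uj0 : u j != 0 by rewrite invr_neq0 // x_neq0 // ltnW.
split; last by rewrite -[x j]invrK -/(u j) fE /f invf_div.
by move: uj0; rewrite fE; apply: contra_neq => den0; rewrite /f den0 mul0r.
Qed.

Lemma y_eq j : (0 < j)%N -> y j = v j * x j.
Proof. by move=> j0; rewrite /v divfK // x_neq0. Qed.

Lemma equal_values_case : v 2%N * u 1%N = v 1%N * u 2%N ->
  y 2%N = y 1%N /\ forall j, (3 <= j)%N ->
    let den := (j%:R - 1) * x 1%N - (j%:R - 2%:R) * x 2%N in
    [/\ den != 0, x j = x 1%N * x 2%N / den & y j = y 1%N].
Proof.
move=> v2E; have y21 : y 2%N = y 1%N.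
  have x12 : (x 1%N)^-1 * (x 2%N)^-1 != 0 by rewrite mulf_neq0 // invr_neq0.
  by apply: (mulIf x12); rewrite mulrA mulrAC v2E mulrA.
split=> // j j3; have j2 := ltnW j3.
pose den (j : nat) := (j%:R - 1) * x 1%N - (j%:R - 2%:R) * x 2%N.
(* Here [v] is affine with values [y 1 / x 1] and [y 1 / x 2] at 1 and 2, hence proportional to
   [den]. *)
have vE i : (0 < i)%N -> v i = y 1%N * (den i / (x 1%N * x 2%N)).
  move=> i0; rewrite (v_affine char0 value_ratio_rel) // /v y21 /den.
  move: (x 1%N) (x 2%N) (y 1%N) i%:R x1_neq0 x2_neq0 => a1 a2 b r a10 a20.
  by field; rewrite a10 a20.
have [||den0 xE] := @x_eq_div den _ _ j j2.
- by rewrite /den; ring.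
- move=> i i0; rewrite !vE // /den -![i.+2%:R]natr1 -![i.+1%:R]natr1.
  move: (x 1%N) (x 2%N) (y 1%N) i%:R x1_neq0 x2_neq0 => a1 a2 b r a10 a20.
  by field; rewrite a10 a20.
split=> //; rewrite y_eq ?(ltnW j2) // vE ?(ltnW j2) // -mulrA xE.
by rewrite -invf_div mulfV ?mulr1 // mulf_neq0 ?invr_neq0 ?mulf_neq0.
Qed.

End NonzeroSlope.
End FirstOrder.

(** * Comparison of coefficients and assembly of the cases *)

Lemma affine_coeffs (K : fieldType) (A B : K) :
  A * 1%:R + B = 0 -> A * 2%:R + B = 0 -> A = 0 /\ B = 0.
Proof.
move=> e1 e2; have A0 : A = 0.
  transitivity ((A * 2%:R + B) - (A * 1%:R + B)); first by ring.
  by rewrite e1 e2 subr0.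
by move: e1; rewrite A0 mul0r add0r.
Qed.

Theorem theorem21 (K : fieldType) (char0 : [pchar K] =i pred0)
    (t : nat -> HCK K) (lam : nat -> nat -> K)
    (tSeq : in_Seq t) (lamLambda : in_Lambda lam) (t_lam : array_of t lam)
    (lam_strong : strong_first_order lam) :
  exists a1 a2 b : K, a1 != 0 /\
  ( (* Case A *)
    [/\ forall i, (0 < i)%N -> lam i 1%N = a1 * i%:R + b,
        forall i, (0 < i)%N -> lam i 2%N = a2 * i%:R + b
      & forall j, (3 <= j)%N ->
        (j%:R - 1) * a1 - (j%:R - 2%:R) * a2 != 0 /\
        forall i, (0 < i)%N ->
          lam i j =
            a1 * a2 * i%:R / ((j%:R - 1) * a1 - (j%:R - 2%:R) * a2) + b]
  \/ (* Case B *)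
    ((forall i, (0 < i)%N -> lam i 2%N = a2 * i%:R - 2%:R * a2) /\
     (forall i j, (0 < i)%N -> (0 < j)%N -> j != 2%N ->
        lam i j = a1 * i%:R - 2%:R * a1))
  \/ (* Case C *)
    [/\ forall i, (0 < i)%N -> lam i 1%N = a1 * i%:R + 2%:R * a1,
        forall i, (0 < i)%N -> lam i 2%N = a2 * i%:R + 4%:R * a2
      & forall j, (3 <= j)%N ->
        (j%:R - 1) * j%:R * (j%:R + 1) / 6%:R * a1
          - (j%:R - 2%:R) * j%:R * (j%:R + 2%:R) / 3%:R * a2 != 0 /\
        forall i, (0 < i)%N ->
          lam i j =
            a1 * a2 * (2%:R * j%:R + i%:R) /
            ((j%:R - 1) * j%:R * (j%:R + 1) / 6%:R * a1
              - (j%:R - 2%:R) * j%:R * (j%:R + 2%:R) / 3%:R * a2)]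
  \/ (* Case D *)
    [/\ forall i, (0 < i)%N -> lam i 1%N = a1 * i%:R + a1,
        forall i, (0 < i)%N -> lam i 2%N = a2 * i%:R + 2%:R * a2
      & forall j, (3 <= j)%N ->
        (j%:R - 1) * j%:R / 2%:R * a1 - (j%:R - 2%:R) * j%:R * a2 != 0 /\
        forall i, (0 < i)%N ->
          lam i j =
            a1 * a2 * (i%:R + j%:R) /
            ((j%:R - 1) * j%:R / 2%:R * a1 - (j%:R - 2%:R) * j%:R * a2)]
  \/ (* Case E *)
    ((forall i, (0 < i)%N -> lam i 1%N = a1 * i%:R + b) /\
     (forall i j, (0 < i)%N -> (2 <= j)%N -> lam i j = 0)) ).
Proof.
have [lamR lamN] := lamLambda; have [lamA [a1 a10 [b1 lam1]]] := lam_strong.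
(* Slope and intercept of column [j], recovered from its entries at [i = 1] and [i = 2]. *)
pose x j := lam 2%N j - lam 1%N j; pose y j := 2%:R * lam 1%N j - lam 2%N j.
have lamE i j : (0 < i)%N -> (0 < j)%N -> lam i j = x j * i%:R + y j.
  by move=> i0 /lamA[a [b E]]; rewrite /x /y !E //; ring.
have x1 : x 1%N != 0.
  by rewrite /x !lam1 //; apply: contra_neq a10 => <-; ring.
clearbody x y.
have rel j k (j0 : (0 < j)%N) (k0 : (0 < k)%N) :
    (x k * j%:R + y k - x j * k%:R - y j) * x (j + k)%N
      = (j%:R - k%:R) * x j * x k /\
    (x k * j%:R + y k - x j * k%:R - y j) * y (j + k)%N
      = j%:R * x k * y j - k%:R * x j * y k.
  (* The terms in [i ^ 2] cancel, so the relation is affine in [i] and its values at 1 and 2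
     determine both coefficients. *)
  have E i : (0 < i)%N ->
      ((j%:R - k%:R) * x j * x k
        - (x k * j%:R + y k - x j * k%:R - y j) * x (j + k)%N) * i%:R
      + (j%:R * x k * y j - k%:R * x j * y k
        - (x k * j%:R + y k - x j * k%:R - y j) * y (j + k)%N) = 0.
    move=> i0; have := lamR i j k i0 j0 k0.
    rewrite !lamE ?addn_gt0 ?i0 ?j0 ?k0 //.
    rewrite !natrD.
    move: (x j) (x k) (y j) (y k) (x _) (y _) i%:R j%:R k%:R.
    move=> xj xk yj yk xs ys a b c /eqP; rewrite -subr_eq0 => /eqP <-.
    by ring.
  have [/eqP + /eqP] := affine_coeffs (E 1%N isT) (E 2%N isT).
  by rewrite !subr_eq0 => /eqP<- /eqP<-.
have x_rel j k j0 k0 := (rel j k j0 k0).1.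
have y_rel j k j0 k0 := (rel j k j0 k0).2.
have nondeg n : (2 <= n)%N -> exists i j,
    [/\ (0 < i)%N, (0 < j)%N, (i + j)%N = n & x j * i%:R + y j != 0].
  by move=> /lamN[i [j [i0 j0 ij]]]; rewrite lamE //; exists i, j.
exists (x 1%N), (x 2%N), (y 1%N); split=> //.
have [x2|x2] := eqVneq (x 2%N) 0.
  have [y2|y2] := eqVneq (y 2%N) 0.
    have xy0 := xy_eq0 x_rel y_rel nondeg x2 y2.
    do 4!right; split=> [i i0|i j i0 j2]; first exact: lamE.
    rewrite lamE ?(ltnW j2) //; have [-> ->] := xy0 j j2.
    by rewrite mul0r addr0.
  have xyE := y_const char0 x_rel y_rel x1 x2 y2.
  left; split=> [i i0|i i0|j j3]; first exact: lamE.
    by rewrite lamE // (xyE _ _).2.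
  split=> [|i i0].
    (* With [a2 = 0] the denominator is [(j - 1) a1]. *)
    rewrite x2 mulr0 subr0 mulf_neq0 // -[in j%:R](ltn_predK j3) -natr1 addrK.
    by rewrite natr_neq0 // -ltnS (ltn_predK j3) ltnW.
  rewrite lamE //; last exact: ltnW (ltnW j3).
  by have [-> ->] := xyE j (ltnW j3); rewrite x2 !(mulr0, mul0r).
have v1N := v1_neqN1 nondeg x1.
have v_rel := value_ratio_rel char0 x_rel y_rel x1 x2.
have u_rel := slope_ratio_rel char0 x_rel x1 x2.
have yE := y_eq char0 x_rel x1 x2.
have xE := x_eq_div char0 x_rel x1 x2.
have [vE|vE|vE|vE] := ratio_classification char0 v_rel u_rel v1N.
- have [y2 xyE] := equal_values_case char0 x_rel y_rel x1 x2 vE.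
  left; split=> [i i0|i i0|j j3]; rewrite ?lamE // ?y2 //.
  have [den0 xj yj] := xyE j j3; split=> // i i0.
  by rewrite lamE ?(ltnW (ltnW j3)) // yj {1}xj mulrAC.
(* For [v = -2] the coefficient of [den 2] in the recurrence is zero, so [den 3 = x 2] whatever
   [den 2] is, and this value persists. *)
- right; left; pose den j := if j == 2%N then x 1%N else x 2%N.
  have x3 j : (0 < j)%N -> j != 2%N -> x j = x 1%N.
    case: j => [|[|[|j]]] // _ _; have [] // := xE den _ _ j.+3.
      case=> [|[|i]] //= _; rewrite /den /= !vE //; first by ring.
      by rewrite -![i.+3%:R]natr1; ring.
    by move=> _ ->; rewrite /den /= mulfK.
  split=> [i i0|i j i0 j0 j2]; rewrite lamE // yE // vE //.
    by ring.
  by rewrite x3 //; ring.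
- right; right; left.
  have n0 n : (0 < n)%N -> n%:R != 0 :> K by exact: natr_neq0.
  (* For [v j = 2 j], the coefficient of [x 1] solves the homogeneous recurrence
     [j w_(j+2) = (j + 3) w_(j+1)] with [w_2 = 1]: it is the binomial coefficient of [j + 1] over 3.
     The [x 2] term is the particular solution vanishing at 2. *)
  pose den j := (j%:R - 1) * j%:R * (j%:R + 1) / 6%:R * x 1%N
    - (j%:R - 2%:R) * j%:R * (j%:R + 2%:R) / 3%:R * x 2%N.
  split=> [i i0|i i0|j j3].
  + by rewrite (lamE i 1%N i0 isT) (yE 1%N isT) (vE 1%N isT); ring.
  + by rewrite (lamE i 2%N i0 isT) (yE 2%N isT) (vE 2%N isT); ring.
  have [||den0 xj] := xE den _ _ j (ltnW j3).
  + by rewrite /den; field; rewrite !n0.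
  + move=> i i0; rewrite !vE // /den -![i.+2%:R]natr1 -![i.+1%:R]natr1.
    move: i%:R (x 1%N) (x 2%N) => r a c.
    by field; rewrite !n0.
  split=> // i i0; have j0 := ltnW (ltnW j3).
  rewrite lamE // yE // vE // xj -/(den j).
  by move: (x 1%N) (x 2%N) (den j)^-1 i%:R j%:R => *; ring.
- do 3!right; left.
  have n0 n : (0 < n)%N -> n%:R != 0 :> K by exact: natr_neq0.
  (* For [v j = j] the homogeneous recurrence is [j w_(j+2) = (j + 2) w_(j+1)], solved by the
     binomial coefficient of [j] over 2. *)
  pose den j := (j%:R - 1) * j%:R / 2%:R * x 1%N
    - (j%:R - 2%:R) * j%:R * x 2%N.
  split=> [i i0|i i0|j j3].
  + by rewrite (lamE i 1%N i0 isT) (yE 1%N isT) (vE 1%N isT); ring.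
  + by rewrite (lamE i 2%N i0 isT) (yE 2%N isT) (vE 2%N isT); ring.
  have [||den0 xj] := xE den _ _ j (ltnW j3).
  + by rewrite /den; field; rewrite !n0.
  + move=> i i0; rewrite !vE // /den -![i.+2%:R]natr1 -![i.+1%:R]natr1.
    move: i%:R (x 1%N) (x 2%N) => r a c.
    by field; rewrite !n0.
  split=> // i i0; have j0 := ltnW (ltnW j3).
  rewrite lamE // yE // vE // xj -/(den j).
  by move: (x 1%N) (x 2%N) (den j)^-1 i%:R j%:R => *; ring.
Qed.
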